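(* If $\mathbf{A}$ is a dually hemimorphic semi-Nelson algebra, then $\mathbf{A}$ is isomorphic (as a dually hemimorphic semi-Nelson algebra) to $\mathbf{V_k(dsH(A))}$.
   Context: **Semi-Heyting algebra**: an algebra $\mathbf{H}=\langle H;\land,\lor,\Rightarrow,0,1\rangle$ of type $(2,2,2,0,0)$ such that $\langle H,\land,\lor,0,1\rangle$ is a bounded lattice and for all $x,y,z\in H$: $x\land(x\Rightarrow y)=x\land y$; $x\land(y\Rightarrow z)=x\land((x\land y)\Rightarrow(x\land z))$; $x\Rightarrow x=1$. **Dually hemimorphic semi-Heyting algebra**: an algebra $\langle H;\land,\lor,\Rightarrow,{}^\dagger,0,1\rangle$ whose reduct without ${}^\dagger$ is a semi-Heyting algebra and which satisfies $0^\dagger=1$, $1^\dagger=0$, $(x\land y)^\dagger=x^\dagger\lor y^\dagger$. **Semi-Nelson algebra**: an algebra $\mathbf{A}=\langle A;\land,\lor,\to,\sim,1\rangle$ of type $(2,2,2,1,0)$ such that, writing $x\to_N y:=x\to(x\land y)$, for all $x,y,z\in A$: (SN1) $x\land(x\lor y)=x$; (SN2) $x\land(y\lor z)=(z\land x)\lor(y\land x)$; (SN3) $\sim\sim x=x$; (SN4) $\sim(x\land y)=\sim x\lor\sim y$; (SN5) $x\land\sim x=(x\land\sim x)\land(y\lor\sim y)$; (SN6) $x\land(x\to_N y)=x\land(\sim x\lor y)$; (SN7) $x\to_N(y\to_N z)=(x\land y)\to_N z$; (SN8) $(x\to_N y)\to_N[(y\to_N x)\to_N[(x\to z)\to_N(y\to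 z)]]=1$; (SN9) $(x\to_N y)\to_N[(y\to_N x)\to_N[(z\to x)\to_N(z\to y)]]=1$; (SN10) $(\sim(x\to y))\to_N(x\land\sim y)=1$; (SN11) $(x\land\sim y)\to_N(\sim(x\to y))=1$. **Dually hemimorphic semi-Nelson algebra**: an algebra $\langle A;\land,\lor,\to,\sim,',1\rangle$ of type $(2,2,2,1,1,0)$ such that $\langle A;\land,\lor,\to,\sim,1\rangle$ is a semi-Nelson algebra and for all $x,y\in A$ (with $\sim x'$ meaning $\sim(x')$): (DSN1) $(\sim 1)'=1$; (DSN2) $1'\to(\sim 1)=1$; (DSN3) $((x\to y)\land(y\to x)\land x')\to_N((x\to y)\land(y\to x)\land y)'=1$; (DSN4) $\sim x'\to(\sim x\land(x'\to x))=1$; (DSN5) $(\sim x\land(x'\to x))\to\sim x'=1$; (DSN6) $(x\land y)'\to(x'\lor y')=1$; (DSN7) $(x'\lor y')\to(x\land y)'=1$. **Quotient $\mathbf{dsH(A)}$**: for a dually hemimorphic semi-Nelson algebra $\mathbf{A}$, put $x\equiv y$ iff $x\to y=1$ and $y\to x=1$. This is an equivalence relation compatible with $\land,\lor,\to,{}'$; $[\![x]\!]$ denotes the class of $x$. $\mathbf{dsH(A)}=\langle A/_\equiv;\cap,\cup,\Rightarrow,{}^\dagger,\bot,\top\rangle$ with $\bot=[\![\sim 1]\!]$, $\top=[\![1]\!]$, $[\![x]\!]\cap[\![y]\!]=[\![x\land y]\!]$, $[\![x]\!]\cup[\![y]\!]=[\![x\lor y]\!]$, $[\![x]\!]\Rightarrow[\![y]\!]=[\![x\to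 y]\!]$, $[\![x]\!]^\dagger=[\![x']\!]$; it is a dually hemimorphic semi-Heyting algebra. **$\mathbf{V_k(H)}$**: for a dually hemimorphic semi-Heyting algebra $\mathbf{H}$, $V_k(H)=\{(a,b)\in H^2:a\land b=0\}$ and $\mathbf{V_k(H)}=\langle V_k(H);\sqcap,\sqcup,\to,\sim,',\top\rangle$ with $(a,b)\sqcap(c,d)=(a\land c,b\lor d)$, $(a,b)\sqcup(c,d)=(a\lor c,b\land d)$, $(a,b)\to(c,d)=(a\Rightarrow c,a\land d)$, $\sim(a,b)=(b,a)$, $(a,b)'=(a^\dagger,b\land(a^\dagger\Rightarrow a))$, $\top=(1,0)$; it is a dually hemimorphic semi-Nelson algebra. *)

(* Defs.v *)
From HB Require Import structures.
From mathcomp Require Import all_boot all_order.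
From mathcomp Require Import boolp.

Set Warnings "-redundant-canonical-projection".
Set Implicit Arguments.
Unset Strict Implicit.
Unset Printing Implicit Defensive.

Import Order.TTheory.

Local Open Scope order_scope.
Local Open Scope quotient_scope.

(* [⇒] need not be the Heyting implication of the lattice: for instance
   [\bot ⇒ \top] may differ from [\top]. *)
HB.mixin Record isSemiHeyting d H of Order.TBLattice d H := {
  shimp : H -> H -> H;
  shimpI : forall x y : H, x `&` shimp x y = x `&` y;
  shimpIr : forall x y z : H,
    x `&` shimp y z = x `&` shimp (x `&` y) (x `&` z);
  shimpxx : forall x : H, shimp x x = \top
}.

#[short(type="semiHeytingType")]
HB.structure Definition SemiHeyting d :=
  {H of isSemiHeyting d H & Order.TBLattice d H}.

Notation "x ⇒ y" := (shimp x y) (at level 55, right associativity).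

HB.mixin Record SemiHeyting_isDuallyHemimorphic d H of SemiHeyting d H := {
  dagger : H -> H;
  dagger0 : dagger \bot = \top;
  dagger1 : dagger \top = \bot;
  daggerI : forall x y : H, dagger (x `&` y) = dagger x `|` dagger y
}.

#[short(type="dhSemiHeytingType")]
HB.structure Definition DHSemiHeyting d :=
  {H of SemiHeyting_isDuallyHemimorphic d H & SemiHeyting d H}.

Notation "x ^†" := (dagger x) (at level 2, left associativity, format "x ^†").

HB.mixin Record hasSemiNelsonOps A := {
  snmeet : A -> A -> A;
  snjoin : A -> A -> A;
  snimp : A -> A -> A;
  snneg : A -> A;
  snone : A
}.

#[short(type="semiNelsonSig")]
HB.structure Definition SemiNelsonSig := {A of hasSemiNelsonOps A}.

Arguments snone {s}.

Declare Scope nelson_scope.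
Delimit Scope nelson_scope with nelson.
Notation "x ⊓ y" := (snmeet x y) (at level 48, left associativity)
  : nelson_scope.
Notation "x ⊔ y" := (snjoin x y) (at level 52, left associativity)
  : nelson_scope.
Notation "x → y" := (snimp x y) (at level 55, right associativity)
  : nelson_scope.
Notation "x →N y" := (snimp x (snmeet x y)) (at level 55, right associativity)
  : nelson_scope.
Notation "∼ x" := (snneg x) (at level 35, right associativity) : nelson_scope.
Notation "1" := snone : nelson_scope.
Local Open Scope nelson_scope.

HB.mixin Record isSemiNelson A of SemiNelsonSig A := {
  sn1 : forall x y : A, x ⊓ (x ⊔ y) = x;
  sn2 : forall x y z : A, x ⊓ (y ⊔ z) = (z ⊓ x) ⊔ (y ⊓ x);
  sn3 : forall x : A, ∼ ∼ x = x;
  sn4 : forall x y : A, ∼ (x ⊓ y) = ∼ x ⊔ ∼ y;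
  sn5 : forall x y : A, x ⊓ ∼ x = (x ⊓ ∼ x) ⊓ (y ⊔ ∼ y);
  sn6 : forall x y : A, x ⊓ (x →N y) = x ⊓ (∼ x ⊔ y);
  sn7 : forall x y z : A, (x →N (y →N z)) = ((x ⊓ y) →N z);
  sn8 : forall x y z : A,
    ((x →N y) →N ((y →N x) →N ((x → z) →N (y → z)))) = 1;
  sn9 : forall x y z : A,
    ((x →N y) →N ((y →N x) →N ((z → x) →N (z → y)))) = 1;
  sn10 : forall x y : A, (∼ (x → y) →N (x ⊓ ∼ y)) = 1;
  sn11 : forall x y : A, ((x ⊓ ∼ y) →N ∼ (x → y)) = 1
}.

#[short(type="semiNelsonType")]
HB.structure Definition SemiNelson :=
  {A of isSemiNelson A & SemiNelsonSig A}.

HB.mixin Record hasNelsonPrime A := { snprime : A -> A }.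

#[short(type="dhSemiNelsonSig")]
HB.structure Definition DHSemiNelsonSig :=
  {A of hasNelsonPrime A & SemiNelsonSig A}.

Notation "x ^′" := (snprime x) (at level 2, left associativity, format "x ^′")
  : nelson_scope.

HB.mixin Record isDHSemiNelson A of SemiNelson A & DHSemiNelsonSig A := {
  dsn1 : (∼ 1 : A)^′ = 1;
  dsn2 : ((1 : A)^′ → ∼ 1) = 1;
  dsn3 : forall x y : A,
    (((x → y) ⊓ (y → x) ⊓ x^′) →N ((x → y) ⊓ (y → x) ⊓ y)^′) = 1;
  dsn4 : forall x : A, (∼ x^′ → (∼ x ⊓ (x^′ → x))) = 1;
  dsn5 : forall x : A, ((∼ x ⊓ (x^′ → x)) → ∼ x^′) = 1;
  dsn6 : forall x y : A, ((x ⊓ y)^′ → (x^′ ⊔ y^′)) = 1;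
  dsn7 : forall x y : A, ((x^′ ⊔ y^′) → (x ⊓ y)^′) = 1
}.

#[short(type="dhSemiNelsonType")]
HB.structure Definition DHSemiNelson :=
  {A of isDHSemiNelson A & SemiNelson A & DHSemiNelsonSig A}.

Definition dhsn_morphism (A B : dhSemiNelsonType) (f : A -> B) : Prop :=
  [/\ {morph f : x y / x ⊓ y}, {morph f : x y / x ⊔ y},
      {morph f : x y / x → y}, {morph f : x / ∼ x}
    & {morph f : x / x^′} /\ f 1 = 1].

Definition dhsn_isomorphic (A B : dhSemiNelsonType) : Prop :=
  exists2 f : A -> B, bijective f & dhsn_morphism f.

Section SemiNelsonTheory.
Variable A : semiNelsonType.
Implicit Types x y z w : A.

Lemma snmeetxx x : x ⊓ x = x.
Proof.
have e : (x ⊓ x) ⊔ (x ⊓ x) = x by rewrite -sn2 sn1.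
have m : (x ⊓ x) ⊓ x = x ⊓ x by rewrite -[X in _ ⊓ X]e sn1.
by rewrite -[X in _ ⊓ X]e sn2 m e.
Qed.

Lemma snjoinxx x : x ⊔ x = x.
Proof. by rewrite -{1 2}[x]snmeetxx -sn2 sn1. Qed.

Lemma snmeetC x y : x ⊓ y = y ⊓ x.
Proof. by rewrite -{1}[y]snjoinxx sn2 snjoinxx. Qed.

Lemma snnegU x y : ∼ (x ⊔ y) = ∼ x ⊓ ∼ y.
Proof. by rewrite -{1}[x]sn3 -{1}[y]sn3 -sn4 sn3. Qed.

Lemma snneg_inj x y : ∼ x = ∼ y -> x = y.
Proof. by move=> e; rewrite -[x]sn3 e sn3. Qed.

Lemma snjoinC x y : x ⊔ y = y ⊔ x.
Proof. by apply: snneg_inj; rewrite !snnegU snmeetC. Qed.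

Lemma snmeetKU x y : x ⊔ (x ⊓ y) = x.
Proof. by apply: snneg_inj; rewrite snnegU sn4 sn1. Qed.

Lemma snmeetUr x y z : x ⊓ (y ⊔ z) = (x ⊓ y) ⊔ (x ⊓ z).
Proof. by rewrite sn2 snjoinC ![_ ⊓ x]snmeetC. Qed.

Lemma snjoinIr x y z : x ⊔ (y ⊓ z) = (x ⊔ y) ⊓ (x ⊔ z).
Proof. by apply: snneg_inj; rewrite !(snnegU, sn4) snmeetUr. Qed.

Lemma snmeetA x y z : x ⊓ (y ⊓ z) = (x ⊓ y) ⊓ z.
Proof.
have K u v w : u ⊔ ((u ⊓ v) ⊓ w) = u by rewrite snjoinIr snmeetKU sn1.
pose p := (x ⊓ y) ⊓ z; pose q := x ⊓ (y ⊓ z).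
have px : p ⊔ x = x by rewrite snjoinC K.
have py : p ⊔ y = y by rewrite snjoinC /p [x ⊓ y]snmeetC K.
have pz : p ⊔ z = z by rewrite snjoinC /p snmeetC snmeetKU.
have qx : q ⊔ x = x by rewrite snjoinC snmeetKU.
have qy : q ⊔ y = y by rewrite snjoinC /q snmeetC K.
have qz : q ⊔ z = z by rewrite snjoinC /q snmeetC [y ⊓ z]snmeetC K.
have pq : p ⊔ q = q by rewrite {2}/q !snjoinIr px py pz.
have qp : q ⊔ p = p by rewrite {2}/p !snjoinIr qx qy qz.
by rewrite -/p -/q -pq snjoinC qp.
Qed.

Lemma snjoinA x y z : x ⊔ (y ⊔ z) = (x ⊔ y) ⊔ z.
Proof. by apply: snneg_inj; rewrite !snnegU snmeetA. Qed.

Definition snle x y := x ⊓ y = x.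

Lemma snle_trans y x z : snle x y -> snle y z -> snle x z.
Proof. by rewrite /snle => xy yz; rewrite -xy -snmeetA yz. Qed.

Lemma snle_anti x y : snle x y -> snle y x -> x = y.
Proof. by rewrite /snle => xy yx; rewrite -xy snmeetC. Qed.

Lemma snleIl x y : snle (x ⊓ y) x.
Proof. by rewrite /snle snmeetC snmeetA snmeetxx. Qed.

Lemma snleIr x y : snle (x ⊓ y) y.
Proof. by rewrite snmeetC; exact: snleIl. Qed.

Lemma snlexI x y z : snle x y -> snle x z -> snle x (y ⊓ z).
Proof. by rewrite /snle => xy xz; rewrite snmeetA xy. Qed.

Lemma snleUl x y : snle x (x ⊔ y).
Proof. exact: sn1. Qed.

Lemma snleUr x y : snle y (x ⊔ y).
Proof. by rewrite snjoinC; exact: sn1. Qed.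

Lemma snleUx x y z : snle x z -> snle y z -> snle (x ⊔ y) z.
Proof. by rewrite /snle => xz yz; rewrite snmeetC sn2 yz xz snjoinC. Qed.

Lemma snle_neg x y : snle x y -> snle (∼ y) (∼ x).
Proof. by rewrite /snle => <-; rewrite sn4 snjoinC sn1. Qed.

Lemma snleU2 x y x' y' : snle x x' -> snle y y' -> snle (x ⊔ y) (x' ⊔ y').
Proof.
move=> hx hy; apply: snleUx; first exact: snle_trans hx (snleUl _ _).
exact: snle_trans hy (snleUr _ _).
Qed.

Lemma snkleene x y : snle (x ⊓ ∼ x) (y ⊔ ∼ y).
Proof. by rewrite /snle -sn5. Qed.

Lemma snle_impNxx x : snle x (x → x).
Proof. by have := sn6 x x; rewrite snmeetxx snjoinC sn1. Qed.

Lemma snimpxx_idem x : (x →N (x → x)) = (x → x).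
Proof. by have := sn7 x x x; rewrite !snmeetxx. Qed.

Lemma snimpxx_imp x z : ((x → x) →N ((x → z) → (x → z))) = 1.
Proof.
by have := sn8 x x z; rewrite !snmeetxx sn7 snmeetxx.
Qed.

Lemma snimpxxxx x : ((x → x) → (x → x)) = 1.
Proof. by rewrite -snimpxx_idem snimpxx_imp. Qed.

Lemma snlex1 x : snle x 1.
Proof.
rewrite -(snimpxxxx x).
exact: snle_trans (snle_impNxx x) (snle_impNxx (x → x)).
Qed.

Lemma snmeetx1 x : x ⊓ 1 = x.
Proof. exact: snlex1. Qed.

Lemma snmeet1x x : 1 ⊓ x = x.
Proof. by rewrite snmeetC snmeetx1. Qed.

Lemma sn1le x : snle 1 x -> x = 1.
Proof. by rewrite /snle snmeet1x. Qed.

Lemma sn0le x : snle (∼ 1) x.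
Proof. by rewrite -[x]sn3; apply: snle_neg; exact: snlex1. Qed.

Lemma snimp1x x : (1 → x) = x.
Proof.
have := sn6 (1 : A) x; rewrite !snmeet1x => ->.
apply: snle_anti; last exact: snleUr.
by apply: snleUx; [exact: sn0le | rewrite /snle snmeetxx].
Qed.

Lemma snimp11 : (1 → 1) = 1 :> A.
Proof. exact: snimp1x. Qed.

Lemma snimpxx x : (x → x) = 1.
Proof. by have := snimpxx_imp 1 x; rewrite !snimp1x !snmeet1x. Qed.

(* The preorder of the underlying Nelson algebra: [x →N y = 1]. *)
Definition sncle x y := (x →N y) = 1.

Lemma sncleE x y : sncle x y <-> snle x (∼ x ⊔ y).
Proof.
rewrite /sncle /snle; split => [e|e]; first by rewrite -sn6 e snmeetx1.
have le : snle x (x →N y) by rewrite /snle sn6.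
by have := sn7 x x y; rewrite le snmeetxx snimpxx.
Qed.

Lemma snle_cle x y : snle x y -> sncle x y.
Proof. by rewrite /sncle /snle => ->; exact: snimpxx. Qed.

Lemma sncle_refl x : sncle x x.
Proof. by apply: snle_cle; exact: snmeetxx. Qed.

Lemma snimpN1x x : (1 →N x) = x.
Proof. by rewrite snmeet1x snimp1x. Qed.

Lemma snimp_congrl x y z : sncle x y -> sncle y x -> sncle (x → z) (y → z).
Proof.
rewrite /sncle => xy yx; have := sn8 x y z; rewrite xy yx.
by rewrite !snimpN1x.
Qed.

Lemma snimp_congrr x y z : sncle x y -> sncle y x -> sncle (z → x) (z → y).
Proof.
rewrite /sncle => xy yx; have := sn9 x y z; rewrite xy yx.
by rewrite !snimpN1x.
Qed.

Lemma sn1cle x : sncle 1 x -> x = 1.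
Proof. by rewrite /sncle snimpN1x. Qed.

Lemma sncle_trans y x z : sncle x y -> sncle y z -> sncle x z.
Proof.
move=> xy yz.
have wz : sncle (x ⊓ y) z.
  by rewrite /sncle -sn7 yz; apply: snle_cle; exact: snlex1.
have xw : sncle x (x ⊓ y).
  apply/sncleE; rewrite snjoinIr; apply: snlexI; first exact: snleUr.
  by apply/sncleE.
have wx : sncle (x ⊓ y) x by apply: snle_cle; exact: snleIl.
have : sncle 1 (x → (x ⊓ y ⊓ z)).
  by rewrite -wz; exact: snimp_congrl.
move=> /sn1cle; rewrite -snmeetA => /sncleE h; apply/sncleE.
apply: snle_trans h _; apply: snleU2; first exact: snmeetxx.
exact: snleIr.
Qed.

Lemma sncleIl x y : sncle (x ⊓ y) x.
Proof. by apply: snle_cle; exact: snleIl. Qed.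

Lemma sncleIr x y : sncle (x ⊓ y) y.
Proof. by apply: snle_cle; exact: snleIr. Qed.

Lemma snclexI x y z : sncle x y -> sncle x z -> sncle x (y ⊓ z).
Proof.
by move=> /sncleE xy /sncleE xz; apply/sncleE; rewrite snjoinIr; exact: snlexI.
Qed.

Lemma sncleUl x y : sncle x (x ⊔ y).
Proof. by apply: snle_cle; exact: snleUl. Qed.

Lemma sncleUr x y : sncle y (x ⊔ y).
Proof. by apply: snle_cle; exact: snleUr. Qed.

Lemma sncleUx x y z : sncle x z -> sncle y z -> sncle (x ⊔ y) z.
Proof.
suff H u v : sncle u z -> sncle v z -> snle u ((∼ u ⊓ ∼ v) ⊔ z).
  move=> xz yz; apply/sncleE; rewrite snnegU; apply: snleUx; first exact: H.
  by rewrite [∼ x ⊓ _]snmeetC; exact: H.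
move=> /sncleE uz /sncleE vz.
rewrite snjoinC snjoinIr ![z ⊔ _]snjoinC; apply: snlexI => //.
rewrite /snle in uz; rewrite -uz snmeetUr; apply: snleUx; last first.
  exact: snle_trans (snleIr _ _) (snleUr _ _).
apply: snle_trans (snkleene u v) _; apply: snleUx => //.
exact: snleUl.
Qed.

Lemma sncle_adj x y z : sncle (x ⊓ y) z <-> sncle x (y →N z).
Proof. by rewrite /sncle sn7. Qed.

Lemma sncle_mp x y : sncle (x ⊓ (x →N y)) y.
Proof. by rewrite snmeetC; apply/sncle_adj; exact: sncle_refl. Qed.

Lemma snimp1_cle x y : (x → y) = 1 -> sncle x y.
Proof.
move=> e; have := sn8 x 1 y; rewrite e.
by rewrite !(snmeetx1, snmeet1x, snimp1x, snimpxx).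
Qed.

Definition sneqv x y := (x → y) = 1 /\ (y → x) = 1.

Lemma sneqvP x y : sneqv x y <-> sncle x y /\ sncle y x.
Proof.
split=> [[xy yx]|[xy yx]]; first by split; exact: snimp1_cle.
split; apply: sn1cle.
  by rewrite -(snimpxx x); exact: snimp_congrr.
by rewrite -(snimpxx y); exact: snimp_congrr.
Qed.

Lemma sneqv_refl x : sneqv x x.
Proof. by split; exact: snimpxx. Qed.

Lemma sneqv_sym x y : sneqv x y -> sneqv y x.
Proof. by case. Qed.

Lemma sneqv_trans y x z : sneqv x y -> sneqv y z -> sneqv x z.
Proof.
move=> /sneqvP[xy yx] /sneqvP[yz zy]; apply/sneqvP.
by split; [exact: sncle_trans xy yz | exact: sncle_trans zy yx].
Qed.

Lemma sneqv_meet x x' y y' : sneqv x x' -> sneqv y y' ->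
  sneqv (x ⊓ y) (x' ⊓ y').
Proof.
move=> /sneqvP[h1 h2] /sneqvP[h3 h4]; apply/sneqvP; split; apply: snclexI;
  by [exact: sncle_trans (sncleIl _ _) _ | exact: sncle_trans (sncleIr _ _) _].
Qed.

Lemma sneqv_join x x' y y' : sneqv x x' -> sneqv y y' ->
  sneqv (x ⊔ y) (x' ⊔ y').
Proof.
move=> /sneqvP[h1 h2] /sneqvP[h3 h4]; apply/sneqvP; split; apply: sncleUx;
  by [apply: sncle_trans (sncleUl _ _) | apply: sncle_trans (sncleUr _ _)].
Qed.

Lemma sneqv_imp x x' y y' : sneqv x x' -> sneqv y y' ->
  sneqv (x → y) (x' → y').
Proof.
move=> /sneqvP[h1 h2] /sneqvP[h3 h4]; apply: (@sneqv_trans (x' → y)).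
  by apply/sneqvP; split; exact: snimp_congrl.
by apply/sneqvP; split; exact: snimp_congrr.
Qed.

Lemma sneqv_ctx_imp x y z :
  sneqv (x ⊓ (y → z)) (x ⊓ ((x ⊓ y) → (x ⊓ z))).
Proof.
have c1 u : sncle x (u →N (x ⊓ u)) by apply/sncle_adj; exact: sncle_refl.
have c2 u : sncle x ((x ⊓ u) →N u).
  by apply/sncle_adj; apply: sncle_trans (sncleIr _ _) (sncleIr _ _).
have mp u v w : sncle x (u →N v) -> sncle x (v →N u) ->
    sncle x ((u → w) →N (v → w)) /\ sncle x ((w → u) →N (w → v)).
  move=> uv vu.
  have H c : ((u →N v) →N ((v →N u) →N c)) = 1 -> sncle x c.
    rewrite sn7 => h.
    by apply: sncle_trans (h : sncle _ c); exact: snclexI.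
  by split; apply: H; [exact: sn8 | exact: sn9].
have comp a b c : sncle x (a →N b) -> sncle x (b →N c) ->
    sncle (x ⊓ a) (x ⊓ c).
  move=> /sncle_adj ab /sncle_adj bc; apply: snclexI; first exact: sncleIl.
  by apply: sncle_trans bc; apply: snclexI => //; exact: sncleIl.
apply/sneqvP; split.
  exact: comp (mp _ _ z (c1 y) (c2 y)).1 (mp _ _ _ (c1 z) (c2 z)).2.
exact: comp (mp _ _ _ (c2 y) (c1 y)).1 (mp _ _ _ (c2 z) (c1 z)).2.
Qed.

End SemiNelsonTheory.

Section DHSemiNelsonTheory.
Variable A : dhSemiNelsonType.
Implicit Types x y z : A.

Lemma sneqv_prime x y : sneqv x y -> sneqv x^′ y^′.
Proof.
move=> [xy yx]; apply/sneqvP; split; rewrite /sncle.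
  by have := dsn3 x y; rewrite xy yx !snmeet1x.
by have := dsn3 y x; rewrite xy yx !snmeet1x.
Qed.

End DHSemiNelsonTheory.

(* The elements of A carry no decidable equality, so the quotient is taken over
   [{classic A}], i.e. A with the classical choiceType structure. *)
Section Quotient.
Variable A : dhSemiNelsonType.

Definition dsH_rel (x y : {classic A}) : bool := `[< sneqv (x : A) y >].

Lemma dsH_rel_refl : reflexive dsH_rel.
Proof. by move=> x; apply/asboolP; exact: sneqv_refl. Qed.

Lemma dsH_rel_sym : symmetric dsH_rel.
Proof. by move=> x y; apply: asbool_equiv_eq; split; exact: sneqv_sym. Qed.

Lemma dsH_rel_trans : transitive dsH_rel.
Proof.
by move=> y x z /asboolP xy /asboolP yz; apply/asboolP; exact: sneqv_trans xy yz.
Qed.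

Canonical dsH_equiv := EquivRel dsH_rel dsH_rel_refl dsH_rel_sym dsH_rel_trans.

Definition dsH := {eq_quot dsH_equiv}.

HB.instance Definition _ := Choice.on dsH.

Definition dsH_class (x : A) : dsH := \pi_dsH (x : {classic A}).

Lemma dsH_classP x y : dsH_class x = dsH_class y <-> sneqv x y.
Proof.
by split=> [/eqmodP/asboolP|h] //; apply/eqmodP; apply/asboolP.
Qed.

Lemma dsH_classW (P : dsH -> Prop) :
  (forall x, P (dsH_class x)) -> forall a, P a.
Proof. by move=> h a; rewrite -[a]reprK; exact: h. Qed.

Let rep (a : dsH) : A := repr a.

Let class_rep a : dsH_class (rep a) = a.
Proof. exact: reprK. Qed.

Definition dsH_meet (a b : dsH) : dsH := dsH_class (rep a ⊓ rep b).
Definition dsH_join (a b : dsH) : dsH := dsH_class (rep a ⊔ rep b).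
Definition dsH_imp (a b : dsH) : dsH := dsH_class (rep a → rep b).
Definition dsH_dagger (a : dsH) : dsH := dsH_class (rep a)^′.
Definition dsH_bot : dsH := dsH_class (∼ 1).
Definition dsH_top : dsH := dsH_class 1.

Let rep_class x : sneqv (rep (dsH_class x)) x.
Proof. by apply/dsH_classP; rewrite class_rep. Qed.

Lemma dsH_meetE x y :
  dsH_meet (dsH_class x) (dsH_class y) = dsH_class (x ⊓ y).
Proof. by apply/dsH_classP; exact: sneqv_meet. Qed.

Lemma dsH_joinE x y :
  dsH_join (dsH_class x) (dsH_class y) = dsH_class (x ⊔ y).
Proof. by apply/dsH_classP; exact: sneqv_join. Qed.

Lemma dsH_impE x y :
  dsH_imp (dsH_class x) (dsH_class y) = dsH_class (x → y).
Proof. by apply/dsH_classP; exact: sneqv_imp. Qed.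

Lemma dsH_daggerE x : dsH_dagger (dsH_class x) = dsH_class x^′.
Proof. by apply/dsH_classP; exact: sneqv_prime. Qed.

Definition dsH_le (a b : dsH) : bool := dsH_meet a b == a.
Definition dsH_lt (a b : dsH) : bool := (b != a) && dsH_le a b.

Lemma dsH_meetC : commutative dsH_meet.
Proof.
by elim/dsH_classW=> x; elim/dsH_classW=> y; rewrite !dsH_meetE snmeetC.
Qed.

Lemma dsH_joinC : commutative dsH_join.
Proof.
by elim/dsH_classW=> x; elim/dsH_classW=> y; rewrite !dsH_joinE snjoinC.
Qed.

Lemma dsH_meetA : associative dsH_meet.
Proof.
elim/dsH_classW=> x; elim/dsH_classW=> y; elim/dsH_classW=> z.
by rewrite !dsH_meetE snmeetA.
Qed.

Lemma dsH_joinA : associative dsH_join.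
Proof.
elim/dsH_classW=> x; elim/dsH_classW=> y; elim/dsH_classW=> z.
by rewrite !dsH_joinE snjoinA.
Qed.

Lemma dsH_joinKI b a : dsH_meet a (dsH_join a b) = a.
Proof.
elim/dsH_classW: a => x; elim/dsH_classW: b => y.
by rewrite dsH_joinE dsH_meetE sn1.
Qed.

Lemma dsH_meetKU b a : dsH_join a (dsH_meet a b) = a.
Proof.
elim/dsH_classW: a => x; elim/dsH_classW: b => y.
by rewrite dsH_meetE dsH_joinE snmeetKU.
Qed.

Lemma dsH_meetUl : left_distributive dsH_meet dsH_join.
Proof.
elim/dsH_classW=> x; elim/dsH_classW=> y; elim/dsH_classW=> z.
by rewrite !(dsH_joinE, dsH_meetE) snmeetC snmeetUr ![z ⊓ _]snmeetC.
Qed.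

Lemma dsH_meetxx : idempotent_op dsH_meet.
Proof. by elim/dsH_classW=> x; rewrite dsH_meetE snmeetxx. Qed.

Fact dsH_display : Order.disp_t. Proof. exact: (Order.Disp tt tt). Qed.

HB.instance Definition _ := Order.isMeetJoinDistrLattice.Build dsH_display dsH
  (fun _ _ => erefl) (fun _ _ => erefl) dsH_meetC dsH_joinC dsH_meetA dsH_joinA
  dsH_joinKI dsH_meetKU dsH_meetUl dsH_meetxx.

Lemma dsH_le0x (a : dsH) : dsH_bot <= a.
Proof.
elim/dsH_classW: a => x; apply/eqP.
by rewrite [LHS]dsH_meetE; congr dsH_class; exact: sn0le.
Qed.

Lemma dsH_lex1 (a : dsH) : a <= dsH_top.
Proof.
by elim/dsH_classW: a => x; apply/eqP; rewrite [LHS]dsH_meetE snmeetx1.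
Qed.

HB.instance Definition _ := Order.hasBottom.Build dsH_display dsH dsH_le0x.
HB.instance Definition _ := Order.hasTop.Build dsH_display dsH dsH_lex1.

Lemma dsH_impI (a b : dsH) : a `&` dsH_imp a b = a `&` b.
Proof.
elim/dsH_classW: a => x; elim/dsH_classW: b => y.
rewrite dsH_impE [LHS]dsH_meetE [RHS]dsH_meetE; apply/dsH_classP.
have h1 := sneqv_ctx_imp x x y; have h2 := sneqv_ctx_imp x 1 y.
rewrite snmeetxx in h1; rewrite snimp1x snmeetx1 in h2.
exact: sneqv_trans h1 (sneqv_sym h2).
Qed.

Lemma dsH_impIr (a b c : dsH) :
  a `&` dsH_imp b c = a `&` dsH_imp (a `&` b) (a `&` c).
Proof.
elim/dsH_classW: a => x; elim/dsH_classW: b => y; elim/dsH_classW: c => z.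
have -> u v : dsH_class u `&` dsH_class v = dsH_class (u ⊓ v).
  exact: dsH_meetE.
rewrite [_ x `&` _ z]dsH_meetE !dsH_impE [LHS]dsH_meetE [RHS]dsH_meetE.
by apply/dsH_classP; exact: sneqv_ctx_imp.
Qed.

Lemma dsH_impxx (a : dsH) : dsH_imp a a = \top.
Proof. by elim/dsH_classW: a => x; rewrite dsH_impE snimpxx. Qed.

HB.instance Definition _ :=
  isSemiHeyting.Build dsH_display dsH dsH_impI dsH_impIr dsH_impxx.

Lemma dsH_dagger0 : dsH_dagger \bot = \top.
Proof. by rewrite [LHS]dsH_daggerE dsn1. Qed.

Lemma dsH_dagger1 : dsH_dagger \top = \bot.
Proof.
rewrite [LHS]dsH_daggerE; apply/dsH_classP/sneqvP; split.
  exact: (snimp1_cle dsn2).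
by apply: snle_cle; exact: sn0le.
Qed.

Lemma dsH_daggerI (a b : dsH) :
  dsH_dagger (a `&` b) = dsH_dagger a `|` dsH_dagger b.
Proof.
elim/dsH_classW: a => x; elim/dsH_classW: b => y.
rewrite [_ `&` _]dsH_meetE !dsH_daggerE [RHS]dsH_joinE.
by apply/dsH_classP; split; [exact: dsn6 | exact: dsn7].
Qed.

HB.instance Definition _ := SemiHeyting_isDuallyHemimorphic.Build
  dsH_display dsH dsH_dagger0 dsH_dagger1 dsH_daggerI.

Lemma dsH_opsE : [/\
  forall x y, dsH_class x `&` dsH_class y = dsH_class (x ⊓ y),
  forall x y, dsH_class x `|` dsH_class y = dsH_class (x ⊔ y),
  forall x y, (dsH_class x ⇒ dsH_class y) = dsH_class (x → y),
  forall x, (dsH_class x)^† = dsH_class x^′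
  & \bot = dsH_class (∼ 1) /\ \top = dsH_class 1].
Proof.
split; [exact: dsH_meetE|exact: dsH_joinE|exact: dsH_impE|exact: dsH_daggerE|].
by [].
Qed.

End Quotient.

Section SemiHeytingTheory.
Variables (d : Order.disp_t) (H : semiHeytingType d).
Implicit Types a b c e : H.

Definition himp a b : H := a ⇒ (a `&` b).

Lemma le_himp c a b : (c <= himp a b) = (c `&` a <= b).
Proof.
apply/idP/idP => h.
  apply: (@le_trans _ _ (a `&` himp a b)).
    by rewrite lexI leIr (le_trans _ h) ?leIl.
  by rewrite shimpI meetA meetxx leIr.
apply/meet_idPl; rewrite shimpIr meetA.
by rewrite [X in _ ⇒ X](meet_idPl h) shimpxx meetx1.
Qed.

Lemma himpA a b c : himp a (himp b c) = himp (a `&` b) c.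
Proof.
apply/le_anti/andP; split; first by rewrite le_himp meetA -!le_himp.
by rewrite !le_himp -meetA -le_himp.
Qed.

Lemma shmeetUr a b c : a `&` (b `|` c) = (a `&` b) `|` (a `&` c).
Proof.
apply/eqP; rewrite eq_le; apply/andP; split; last first.
  by rewrite leUx !lexI !leIl /= !(le_trans (leIr _ _)) ?leUl ?leUr.
by rewrite meetC -le_himp leUx !le_himp ![_ `&` a]meetC leUl leUr.
Qed.

Lemma shjoinIr a b c : a `|` (b `&` c) = (a `|` b) `&` (a `|` c).
Proof.
rewrite shmeetUr [X in _ = X `|` _]meetC joinKI [X in _ = _ `|` X]meetC.
by rewrite shmeetUr joinA [c `&` a]meetC meetKU [c `&` b]meetC.
Qed.

Lemma shimp1x a : (\top ⇒ a) = a.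
Proof. by have := shimpI (\top : H) a; rewrite !meet1x. Qed.

Lemma shimp_ctx t a b c : t `&` a = t `&` b ->
  (t `&` (a ⇒ c) <= (b ⇒ c)) /\ (t `&` (c ⇒ a) <= (c ⇒ b)).
Proof.
move=> e; split.
  by rewrite shimpIr e -shimpIr leIr.
by rewrite shimpIr e -shimpIr leIr.
Qed.

Lemma himp_ctx a b :
  (himp a b `&` himp b a) `&` a = (himp a b `&` himp b a) `&` b.
Proof.
have K x y : (himp x y `&` himp y x) `&` x <= (himp x y `&` himp y x) `&` y.
  by rewrite lexI leIl -le_himp leIl.
by apply/le_anti; rewrite K [himp a b `&` _]meetC K.
Qed.

End SemiHeytingTheory.

Section Vakarelov.
Variables (d : Order.disp_t) (H : dhSemiHeytingType d).
Implicit Types a b c e : H.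

Definition Vk : Type := {p : H * H | p.1 `&` p.2 == \bot}.

Implicit Types p q r : Vk.

Lemma VkP p : (val p).1 `&` (val p).2 = \bot.
Proof. exact/eqP/(valP p). Qed.

Lemma Vk_eq p q : (val p).1 = (val q).1 -> (val p).2 = (val q).2 -> p = q.
Proof.
move=> e1 e2; apply: val_inj.
by rewrite [LHS]surjective_pairing e1 e2 -surjective_pairing.
Qed.

Definition mkVk a b (h : a `&` b = \bot) : Vk :=
  exist _ (a, b) (introT eqP h).

Lemma Vk_meet_subproof p q :
  ((val p).1 `&` (val q).1) `&` ((val p).2 `|` (val q).2) = \bot.
Proof.
rewrite shmeetUr -[X in _ `|` X]meetA VkP meetx0 joinx0.
by rewrite meetAC VkP meet0x.
Qed.

Definition Vk_meet p q : Vk :=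
  @mkVk ((val p).1 `&` (val q).1) ((val p).2 `|` (val q).2)
    (Vk_meet_subproof p q).

Lemma Vk_join_subproof p q :
  ((val p).1 `|` (val q).1) `&` ((val p).2 `&` (val q).2) = \bot.
Proof.
rewrite meetC shmeetUr -[X in _ `|` X]meetA [_ `&` (val q).1]meetC VkP.
by rewrite meetx0 joinx0 meetAC [_ `&` (val p).1]meetC VkP meet0x.
Qed.

Definition Vk_join p q : Vk :=
  @mkVk ((val p).1 `|` (val q).1) ((val p).2 `&` (val q).2)
    (Vk_join_subproof p q).

Lemma Vk_imp_subproof p q :
  ((val p).1 ⇒ (val q).1) `&` ((val p).1 `&` (val q).2) = \bot.
Proof.
by rewrite meetA [_ `&` (val p).1]meetC shimpI -meetA VkP meetx0.
Qed.

Definition Vk_imp p q : Vk :=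
  @mkVk ((val p).1 ⇒ (val q).1) ((val p).1 `&` (val q).2)
    (Vk_imp_subproof p q).

Lemma Vk_neg_subproof p : (val p).2 `&` (val p).1 = \bot.
Proof. by rewrite meetC VkP. Qed.

Definition Vk_neg p : Vk :=
  @mkVk (val p).2 (val p).1
    (Vk_neg_subproof p).

Lemma Vk_prime_subproof p :
  (val p).1^† `&` ((val p).2 `&` ((val p).1^† ⇒ (val p).1)) = \bot.
Proof.
by rewrite meetCA shimpI meetCA [_ `&` (val p).1]meetC VkP meetx0.
Qed.

Definition Vk_prime p : Vk :=
  @mkVk (val p).1^† ((val p).2 `&` ((val p).1^† ⇒ (val p).1))
    (Vk_prime_subproof p).

Definition Vk_one : Vk := @mkVk \top \bot (meet1x \bot).

HB.instance Definition _ :=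
  hasSemiNelsonOps.Build Vk Vk_meet Vk_join Vk_imp Vk_neg Vk_one.
HB.instance Definition _ := hasNelsonPrime.Build Vk Vk_prime.

Lemma Vk_impN1 p q : (val p).1 <= (val q).1 -> (p →N q) = 1.
Proof.
move=> le; apply: Vk_eq => /=.
  by rewrite (meet_idPl le) shimpxx.
apply/eqP; rewrite -lex0 shmeetUr VkP join0x.
apply: (@le_trans _ _ ((val q).1 `&` (val q).2)); last by rewrite VkP.
exact: leI2.
Qed.

Lemma Vk_imp1 p q : (val p).1 = (val q).1 -> (p → q) = 1.
Proof. by move=> e; apply: Vk_eq; rewrite /= ?e ?shimpxx ?VkP. Qed.

Lemma Vk_sn1 p q : p ⊓ (p ⊔ q) = p.
Proof. by apply: Vk_eq; rewrite /= ?joinKI ?meetKU. Qed.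

Lemma Vk_sn2 p q r : p ⊓ (q ⊔ r) = (r ⊓ p) ⊔ (q ⊓ p).
Proof.
apply: Vk_eq => /=.
  by rewrite shmeetUr joinC ![_ `&` (val p).1]meetC.
by rewrite shjoinIr meetC ![_ `|` (val p).2]joinC.
Qed.

Lemma Vk_sn3 p : ∼ ∼ p = p.
Proof. exact: Vk_eq. Qed.

Lemma Vk_sn4 p q : ∼ (p ⊓ q) = ∼ p ⊔ ∼ q.
Proof. exact: Vk_eq. Qed.

Lemma Vk_sn5 p q : p ⊓ ∼ p = (p ⊓ ∼ p) ⊓ (q ⊔ ∼ q).
Proof.
apply: Vk_eq => /=; first by rewrite VkP meet0x.
by rewrite [(val q).2 `&` _]meetC VkP joinx0.
Qed.

Lemma Vk_sn6 p q : p ⊓ (p →N q) = p ⊓ (∼ p ⊔ q).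
Proof.
apply: Vk_eq; last by rewrite /= shmeetUr VkP join0x.
by rewrite /= shimpI shmeetUr VkP join0x meetA meetxx.
Qed.

Lemma Vk_sn7 p q r : (p →N (q →N r)) = ((p ⊓ q) →N r).
Proof.
have E p' q' : (val (p' →N q')).2 = (val p').1 `&` (val q').2.
  by rewrite /= shmeetUr VkP join0x.
by apply: Vk_eq; [exact: himpA | rewrite !E meetA].
Qed.

Lemma Vk_sn8 p q r :
  ((p →N q) →N ((q →N p) →N ((p → r) →N (q → r)))) = 1.
Proof.
rewrite !Vk_sn7; apply: Vk_impN1; rewrite [val _]/= -!/(himp _ _).
set a := (val p).1; set c := (val q).1; set e := (val r).1.
by case: (shimp_ctx e (himp_ctx a c)).
Qed.

Lemma Vk_sn9 p q r :
  ((p →N q) →N ((q →N p) →N ((r → p) →N (r → q)))) = 1.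
Proof.
rewrite !Vk_sn7; apply: Vk_impN1; rewrite [val _]/= -!/(himp _ _).
set a := (val p).1; set c := (val q).1; set e := (val r).1.
by case: (shimp_ctx e (himp_ctx a c)).
Qed.

Lemma Vk_sn10 p q : (∼ (p → q) →N (p ⊓ ∼ q)) = 1.
Proof. exact: Vk_impN1. Qed.

Lemma Vk_sn11 p q : ((p ⊓ ∼ q) →N ∼ (p → q)) = 1.
Proof. exact: Vk_impN1. Qed.

HB.instance Definition _ := isSemiNelson.Build Vk
  Vk_sn1 Vk_sn2 Vk_sn3 Vk_sn4 Vk_sn5 Vk_sn6 Vk_sn7 Vk_sn8 Vk_sn9 Vk_sn10 Vk_sn11.

Lemma Vk_dsn1 : (∼ 1 : Vk)^′ = 1.
Proof.
apply: Vk_eq => /=; first exact: dagger0.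
by rewrite dagger0 shimp1x meetx0.
Qed.

Lemma Vk_dsn2 : ((1 : Vk)^′ → ∼ 1) = 1.
Proof. by apply: Vk_imp1; rewrite /= dagger1. Qed.

Lemma Vk_dsn3 p q :
  (((p → q) ⊓ (q → p) ⊓ p^′) →N ((p → q) ⊓ (q → p) ⊓ q)^′) = 1.
Proof.
apply: Vk_impN1 => /=; set a := (val p).1; set c := (val q).1.
have -> : (a ⇒ c) `&` (c ⇒ a) `&` c = (a ⇒ c) `&` (c ⇒ a) `&` a.
  transitivity (a `&` c).
    rewrite -meetA [(c ⇒ a) `&` c]meetC shimpI [c `&` a]meetC meetA [_ `&` a]meetC shimpI.
    by rewrite -meetA meetxx.
  rewrite meetAC [(a ⇒ c) `&` a]meetC shimpI -meetA shimpI.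
  by rewrite meetCA meetxx meetC.
by rewrite daggerI; apply: le_trans (leIr _ _) (leUr _ _).
Qed.

Lemma Vk_dsn4 p : (∼ p^′ → (∼ p ⊓ (p^′ → p))) = 1.
Proof. exact: Vk_imp1. Qed.

Lemma Vk_dsn5 p : ((∼ p ⊓ (p^′ → p)) → ∼ p^′) = 1.
Proof. exact: Vk_imp1. Qed.

Lemma Vk_dsn6 p q : ((p ⊓ q)^′ → (p^′ ⊔ q^′)) = 1.
Proof. by apply: Vk_imp1; rewrite /= daggerI. Qed.

Lemma Vk_dsn7 p q : ((p^′ ⊔ q^′) → (p ⊓ q)^′) = 1.
Proof. by apply: Vk_imp1; rewrite /= daggerI. Qed.

HB.instance Definition _ := isDHSemiNelson.Build Vk
  Vk_dsn1 Vk_dsn2 Vk_dsn3 Vk_dsn4 Vk_dsn5 Vk_dsn6 Vk_dsn7.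

End Vakarelov.

(* Main.v *)
(** The isomorphism sends [x] to the pair of classes of [x] and [∼ x].
    Injectivity and compatibility with the operations hold as for Vakarelov's
    construction over Nelson algebras. There, surjectivity can fail; here it
    holds because [c = 1′] is a centre: both [c] and [∼ c] are equivalent to
    [∼ 1], so that [c] represents the pair [(⊥, ⊥)]. Consequently a pair
    [(⟦a⟧, ⟦b⟧)] with [a ⊓ b] equivalent to [∼ 1] is the image of
    [(a ⊔ c) ⊓ (b →N ∼ 1)]. *)
From mathcomp Require Import all_boot all_order.
From mathcomp Require Import boolp.
Require Import Defs.

Set Implicit Arguments.
Unset Strict Implicit.
Unset Printing Implicit Defensive.

Import Order.TTheory.

Local Open Scope order_scope.
Local Open Scope nelson_scope.

Section SemiNelson.
Variable A : semiNelsonType.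
Implicit Types x y a b : A.

Lemma sncle0x x : sncle (∼ 1) x.
Proof. exact/snle_cle/sn0le. Qed.

Lemma sneqv_meetN x : sneqv (x ⊓ ∼ x) (∼ 1).
Proof.
apply/sneqvP; split; last exact: sncle0x.
apply/sncleE; rewrite sn4 sn3.
apply: snle_trans (snleUl _ _); apply: snle_trans (snleIl _ _) _.
exact: snleUr.
Qed.

Lemma sneqv_negimp x y : sneqv (∼ (x → y)) (x ⊓ ∼ y).
Proof. by apply/sneqvP; split; [exact: sn10 | exact: sn11]. Qed.

(** The hypotheses amount to [x ≤ ∼ x ⊔ y] and [x ⊓ ∼ y ≤ y]. The first splits [x] into [x ⊓ ∼ x]
    and [x ⊓ y]; the Kleene law puts [x ⊓ ∼ x] below [x ⊓ (y ⊔ ∼ y)], whose two parts lie below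
    [y]. *)
Lemma sncle_snle x y : sncle x y -> sncle (∼ y) (∼ x) -> snle x y.
Proof.
move=> /sncleE xy /sncleE /snle_neg; rewrite snnegU !sn3 => yx.
have xNyy : snle (x ⊓ ∼ y) y by rewrite snmeetC.
rewrite -{1}xy snmeetUr; apply: snleUx; last exact: snleIr.
apply: (@snle_trans _ (x ⊓ (y ⊔ ∼ y))).
  by apply: snlexI; [exact: snleIl | exact: snkleene].
by rewrite snmeetUr; apply: snleUx; [exact: snleIr | exact: xNyy].
Qed.

Lemma sneqv_inj x y : sneqv x y -> sneqv (∼ x) (∼ y) -> x = y.
Proof.
by move=> /sneqvP[xy yx] /sneqvP[nxy nyx]; apply: snle_anti; exact: sncle_snle.
Qed.

(** Joining [c] leaves the class of [a] unchanged, and [b →N ∼ 1] is above [a] by adjunction. Under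
    negation, [∼ c] annihilates [∼ a], so only [∼ (b →N ∼ 1)] remains. *)
Lemma sneqv_centre_pair c a b :
  sncle c (∼ 1) -> sncle (∼ c) (∼ 1) -> sncle (a ⊓ b) (∼ 1) ->
  sneqv ((a ⊔ c) ⊓ (b →N ∼ 1)) a /\ sneqv (∼ ((a ⊔ c) ⊓ (b →N ∼ 1))) b.
Proof.
move=> c0 nc0 /sncle_adj ab0; split.
  apply/sneqvP; split; last by apply: snclexI => //; exact: sncleUl.
  apply: sncle_trans (sncleIl _ _) _; apply: sncleUx; first exact: sncle_refl.
  exact: sncle_trans c0 (sncle0x _).
have /sneqvP[nb bn] : sneqv (∼ (b →N ∼ 1)) b.
  (* Here [∼ (b ⊓ ∼ 1)] is [∼ b ⊔ 1], that is [1], so the meet with [b] reduces to [b]. *)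
  have := sneqv_negimp b (b ⊓ ∼ 1).
  by rewrite sn4 sn3 [∼ b ⊔ 1]snjoinC -[1 ⊔ _]snmeet1x sn1 snmeetx1.
rewrite sn4 snnegU; apply/sneqvP; split.
  apply: sncleUx => //; apply: sncle_trans (sncleIr _ _) _.
  exact: sncle_trans nc0 (sncle0x _).
exact: sncle_trans bn (sncleUr _ _).
Qed.

End SemiNelson.

Section Representation.
Variable A : dhSemiNelsonType.
Implicit Types x y : A.

(** Matches the second coordinate of the prime in [Vk], as [sneqv_negimp] does for [→]. *)
Lemma sneqv_negprime x : sneqv (∼ x^′) (∼ x ⊓ (x^′ → x)).
Proof. by split; [exact: dsn4 | exact: dsn5]. Qed.

Lemma sncle_prime1 : sncle ((1 : A)^′) (∼ 1).
Proof. exact/snimp1_cle/dsn2. Qed.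

Lemma sncle_negprime1 : sncle (∼ (1 : A)^′) (∼ 1).
Proof.
have /sneqvP[h _] := sneqv_negprime 1; exact: sncle_trans h (sncleIl _ _).
Qed.

Lemma to_Vk_subproof x : dsH_class x `&` dsH_class (∼ x) = \bot.
Proof. by rewrite [LHS]dsH_meetE; apply/dsH_classP; exact: sneqv_meetN. Qed.

Definition to_Vk x : Vk (dsH A) := mkVk (to_Vk_subproof x).

Lemma to_Vk_inj : injective to_Vk.
Proof.
by move=> x y [/dsH_classP xy /dsH_classP nxy]; exact: sneqv_inj.
Qed.

Lemma to_Vk_surj p : exists x, to_Vk x = p.
Proof.
case: p => -[a b]; elim/dsH_classW: a => a; elim/dsH_classW: b => b h.
have /eqP : dsH_class a `&` dsH_class b == \bot := h.
rewrite [LHS]dsH_meetE => /dsH_classP/sneqvP[ab0 _].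
have [za zb] := sneqv_centre_pair sncle_prime1 sncle_negprime1 ab0.
by exists ((a ⊔ 1^′) ⊓ (b →N ∼ 1)); apply: Vk_eq; apply/dsH_classP.
Qed.

Lemma to_Vk_bij : bijective to_Vk.
Proof.
(* Choice turns surjectivity into a right inverse, which injectivity makes two-sided. *)
have [g gK] := choice to_Vk_surj.
by exists g => // x; apply: to_Vk_inj; rewrite gK.
Qed.

Lemma to_Vk_morphism : dhsn_morphism to_Vk.
Proof.
split=> [x y|x y|x y|x|].
- apply: Vk_eq => /=; first by rewrite [RHS]dsH_meetE.
  by rewrite [RHS]dsH_joinE sn4.
- apply: Vk_eq => /=; first by rewrite [RHS]dsH_joinE.
  by rewrite [RHS]dsH_meetE snnegU.
- apply: Vk_eq => /=; first by rewrite [RHS]dsH_impE.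
  by rewrite [RHS]dsH_meetE; apply/dsH_classP; exact: sneqv_negimp.
- by apply: Vk_eq => //=; rewrite sn3.
split=> [x|]; last exact: Vk_eq.
have daggerE : (dsH_class x)^† = dsH_class x^′ by exact: dsH_daggerE.
apply: Vk_eq; rewrite /= daggerE //.
have -> : (dsH_class x^′ ⇒ dsH_class x) = dsH_class (x^′ → x).
  exact: dsH_impE.
by rewrite [RHS]dsH_meetE; apply/dsH_classP; exact: sneqv_negprime.
Qed.

End Representation.

Theorem theorem4p6 (A : dhSemiNelsonType) : dhsn_isomorphic A (Vk (dsH A)).
Proof. by exists (@to_Vk A); [exact: to_Vk_bij | exact: to_Vk_morphism]. Qed.
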